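(* Let $N\ge 1$, let $a,f,b>0$ be real constants, let $G$ be a weighted directed graph on the vertices $1,\dots,N$ with adjacency matrix $W=(w_{ij})\in\mathbb{R}^{N\times N}$, $w_{ij}\ge 0$, and let $v:[0,\infty)\to\mathbb{R}$ be a (piecewise continuous) input function. Let $\lambda_1,\dots,\lambda_N\in\mathbb{C}$ be the eigenvalues (with multiplicity) of the Laplacian matrix $L$ of $G$. Then the forced system $$\dot{x}_i(t)=a\,x_i(t)+f\sum_{j=1}^{N}w_{ij}\,(x_j(t)-x_i(t))+b\,v(t),\qquad i=1,\dots,N,$$ achieves consensus if and only if both of the following hold: (1) $G$ includes a spanning tree; (2) for every $i\in\{1,\dots,N\}$ with $\lambda_i\neq 0$, the number $a-\lambda_i f$ has negative real part.
   Context: The state $x_i(t)\in\mathbb{R}$ belongs to agent $i$, and the input $v$ is the same for all agents. The weight of the arc of $G$ from vertex $j$ to vertex $i$ is $w_{ij}\ge 0$, and there is an arc from $j$ to $i$ exactly when $w_{ij}>0$. The Laplacian matrix is $L=D-W$, where $D$ is the diagonal in-degree matrix with $D_{ii}=\sum_{j=1}^N w_{ij}$. $G$ includes a spanning tree if there is a vertex (root) from which every other vertex can be reached by a directed path. The system achieves consensus if, for every initial state $(x_1(0),\dots,x_N(0))\in\mathbb{R}^N$, the corresponding solution satisfies $\lim_{t\to\infty}(x_i(t)-x_j(t))=0$ for all $i,j\in\{1,\dots,N\}$. *)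

(* Defs.v *)
(* MathComp world, with MathComp-Analysis and real-closed's complex numbers. *)
From HB Require Import structures.
From mathcomp Require Import all_boot all_order all_algebra.
From mathcomp Require Import complex.
From mathcomp Require Import all_classical all_reals all_analysis.

Set Implicit Arguments.
Unset Strict Implicit.
Unset Printing Implicit Defensive.

Import Order.TTheory GRing.Theory Num.Theory.
Import numFieldNormedType.Exports.

Local Open Scope classical_set_scope.
Local Open Scope ring_scope.

(* W i j is the weight of the arc from j to i, so the degree of vertex i is
   its in-degree, the i-th row sum. *)
Definition laplacian (R : realType) (N : nat) (W : 'M[R]_N) : 'M[R]_N :=
  diag_mx (\row_i \sum_j W i j) - W.

Definition arc (R : realType) (N : nat) (W : 'M[R]_N) : rel 'I_N :=
  fun j i => 0 < W i j.

Definition has_spanning_tree (R : realType) (N : nat) (W : 'M[R]_N) : Prop :=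
  exists r : 'I_N, forall i : 'I_N, connect (arc W) r i.

(* lam lists the complex eigenvalues of the real matrix A with their algebraic
   multiplicities. *)
Definition eigenvalues_with_mult (R : realType) (N : nat) (A : 'M[R]_N)
    (lam : 'I_N -> R[i]) : Prop :=
  char_poly (map_mx (real_complex R) A) = \prod_(i < N) ('X - (lam i)%:P).

(* Functions on [0, +oo[ are represented by functions on R whose values at
   negative reals are never used. *)
Definition piecewise_continuous (R : realType) (v : R -> R) : Prop :=
  [/\ forall T : R,
        finite_set [set t : R | 0 < t <= T /\ ~ {for t, continuous v}],
      forall t : R, 0 <= t -> cvg (v @ t^'+)
    & forall t : R, 0 < t -> cvg (v @ t^'-)].

(* At a discontinuity of v a solution need not be differentiable, so there it
   is only required to be continuous. No equation is imposed at t = 0, where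
   the one-sided one follows by continuity when v is right-continuous. *)
Definition is_solution (R : realType) (N : nat) (a f b : R) (W : 'M[R]_N)
    (v : R -> R) (x : 'I_N -> R -> R) : Prop :=
  forall i : 'I_N,
    {within `[0, +oo[, continuous (x i)} /\
    forall t : R, 0 < t -> {for t, continuous v} ->
      is_derive t 1 (x i)
        (a * x i t + f * (\sum_j W i j * (x j t - x i t)) + b * v t).

Definition achieves_consensus (R : realType) (N : nat) (a f b : R)
    (W : 'M[R]_N) (v : R -> R) : Prop :=
  forall (x0 : 'I_N -> R) (x : 'I_N -> R -> R),
    is_solution a f b W v x -> (forall i : 'I_N, x i 0 = x0 i) ->
    forall i j : 'I_N, x i t - x j t @[t --> +oo] --> (0 : R).

(* Main.v *)
Require Import Defs.
From HB Require Import structures.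
From mathcomp Require Import all_boot all_order all_algebra.
From mathcomp Require Import complex ring lra.
From mathcomp Require Import all_classical all_reals all_analysis.
From mathcomp Require Import measurable_realfun.

Set Implicit Arguments.
Unset Strict Implicit.
Unset Printing Implicit Defensive.

Import Order.TTheory GRing.Theory Num.Theory.
Import numFieldNormedType.Exports.

Local Open Scope complex_scope.
Local Open Scope ring_scope.

(* Row vectors w with w 1 = 0 kill the common input b v, so w x obeys the
   homogeneous equation (w x)' = w (a - f L) x.

   Sufficiency: a spanning tree makes the generalized kernel of L the constants
   (maximum principle), so by Cayley-Hamilton e_i - e_j is killed by the product
   of the L - lam_k over the nonzero eigenvalues. Peeling these factors off one
   at a time, w x solves a stable scalar equation whose forcing term
   - f w (L - lam_k) x already tends to 0.

   Necessity: adding the real part of e^(mu t) z, where L z = l z and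
   mu = a - l f, to a solution shows that z is constant as soon as Re mu >= 0. This applies to
   unstable modes and, as a > 0, to the kernel of L; without a spanning tree
   that kernel contains a nonconstant vector, because two disjoint sets of
   vertices without incoming arcs carry independent left null vectors. *)

(** * Real kernel and left null vectors of a weighted Laplacian *)

Section LaplacianAlgebra.
Variables (R : realType) (N : nat) (W : 'M[R]_N).
Hypothesis W_ge0 : forall i j : 'I_N, 0 <= W i j.

Lemma laplacian_mul_col (x : 'cV[R]_N) (i : 'I_N) :
  (laplacian W *m x) i 0 = \sum_j W i j * (x i 0 - x j 0).
Proof.
rewrite /laplacian mulmxBl mul_diag_mx !mxE mulr_suml -sumrB.
by apply: eq_bigr => j _; rewrite mulrBr.
Qed.

Lemma laplacian_const (c : R) : laplacian W *m const_mx c = 0 :> 'cV_N.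
Proof.
apply/matrixP => i j; rewrite ord1 laplacian_mul_col [RHS]mxE.
by rewrite big1// => k _; rewrite !mxE subrr mulr0.
Qed.

Lemma laplacian_offdiag (i j : 'I_N) : i != j -> laplacian W i j = - W i j.
Proof. by move=> ij; rewrite !mxE (negbTE ij) mulr0n add0r. Qed.

(* Where x is maximal, the terms of (L x) are nonnegative, so a zero sum
   forces x to be maximal at all in-neighbours, hence at the root. *)
Lemma laplacian_const_image_root (r : 'I_N) (x : 'cV[R]_N) (c : R) :
  (forall i, connect (Defs.arc W) r i) ->
  (forall i, (laplacian W *m x) i 0 = c) ->
  0 <= c /\ (c = 0 -> forall i, x i 0 <= x r 0).
Proof.
move=> rootr Lxc.
have [m mmax] : exists m, forall i, x i 0 <= x m 0.
  have [//|m _ h] := @arg_maxP _ _ _ r xpredT (fun i => x i 0).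
  by exists m => i; exact: h.
have term_ge0 k i : (forall j, x j 0 <= x k 0) -> 0 <= W k i * (x k 0 - x i 0).
  by move=> h; rewrite mulr_ge0// subr_ge0.
split.
  by rewrite -(Lxc m) laplacian_mul_col sumr_ge0// => i _; exact: term_ge0.
move=> c0 i; apply: le_trans (mmax i) _.
have pred_max j k : Defs.arc W j k -> (forall i, x i 0 <= x k 0) -> x j 0 = x k 0.
  move=> jk kmax; have := Lxc k.
  rewrite c0 laplacian_mul_col => /psumr_eq0P.
  move=> /(_ (fun i _ => term_ge0 k i kmax) j isT) /eqP.
  by rewrite mulf_eq0 gt_eqF//= subr_eq0 => /eqP.
suff -> : x r 0 = x m 0 by [].
have /connectP[p] := rootr m; elim: p {rootr} r => [|q p IH] r /=.
  by move=> _ ->.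
move=> /andP[rq qp] mE.
have qm := IH q qp mE.
by rewrite (pred_max _ _ rq)// => j; rewrite qm.
Qed.

(** The one-sided bounds for x and for -x squeeze both c and the entries of x. Allowing an unknown
    constant c on the right is what lets powers of L be peeled off later. *)
Lemma spanning_tree_laplacian_const (x : 'cV[R]_N) (c : R) :
  has_spanning_tree W -> (forall i, (laplacian W *m x) i 0 = c) ->
  c = 0 /\ forall i j, x i 0 = x j 0.
Proof.
move=> [r rootr] Lxc.
have [c_ge0 xmax] := laplacian_const_image_root rootr Lxc.
have LxNc i : (laplacian W *m (- x)) i 0 = - c by rewrite mulmxN mxE Lxc.
have [Nc_ge0 xmin] := laplacian_const_image_root rootr LxNc.
have c0 : c = 0 by apply/eqP; rewrite eq_le c_ge0 -oppr_ge0 Nc_ge0.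
have xr i : x i 0 = x r 0.
  apply/eqP; rewrite eq_le xmax//=.
  by have := xmin _ i; rewrite c0 oppr0 !mxE lerN2; apply.
by split=> // i j; rewrite !xr.
Qed.

(** No arc enters [S], so the block of L on [S] has zero row sums and is singular; a left null
    vector of that block extends by zero. *)
Lemma laplacian_left_null (S : {set 'I_N}) (s : 'I_N) : s \in S ->
  (forall i j, i \in S -> Defs.arc W j i -> j \in S) ->
  exists u : 'rV[R]_N,
    [/\ u != 0, u *m laplacian W = 0 & forall j, j \notin S -> u 0 j = 0].
Proof.
move=> sS Sclosed.
have LS0 i j : i \in S -> j \notin S -> laplacian W i j = 0.
  move=> iS jS; rewrite laplacian_offdiag; last by apply: contraNneq jS => <-.
  apply/eqP; rewrite oppr_eq0; apply: contraNT jS => Wij.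
  by apply: Sclosed iS _; rewrite /Defs.arc lt0r Wij W_ge0.
(* The rows of L outside S are replaced by those of the identity; the
   resulting matrix kills the indicator of S, hence is singular. *)
pose M := \matrix_(i, j) if i \in S then laplacian W i j else (i == j)%:R.
pose x : 'cV[R]_N := \col_i (i \in S)%:R.
have Mx : M *m x = 0.
  apply/matrixP => i j; rewrite !mxE.
  have [iS|iS] := boolP (i \in S); last first.
    rewrite big1// => k _; rewrite !mxE (negbTE iS).
    by have [<-|] := eqVneq i k; rewrite ?(negbTE iS) ?mulr0 ?mul0r.
  transitivity ((laplacian W *m (const_mx 1 : 'cV_N)) i j).
    rewrite mxE; apply: eq_bigr => k _; rewrite [M _ _]mxE [x _ _]mxE iS.
    rewrite [const_mx _ _ _]mxE.
    by have [//|kS] := boolP (k \in S); rewrite LS0// !mul0r.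
  by rewrite laplacian_const mxE.
have /det0P[u u0 uM] : \det M == 0.
  rewrite -det_tr; apply/det0P; exists x^T.
    apply/negP => /eqP/matrixP/(_ 0 s)/eqP.
    by rewrite !mxE sS oner_eq0.
  by rewrite -trmx_mul Mx trmx0.
(* For j outside [S], column j of [M] is the j-th unit vector, so (u M)_j = u_j. *)
have uN j : j \notin S -> u 0 j = 0.
  move=> jS; have := congr1 (fun A : 'rV_N => A 0 j) uM.
  rewrite !mxE (bigD1 j)//= mxE (negbTE jS) eqxx mulr1 big1 ?addr0//.
  move=> i ij; rewrite mxE (negbTE ij).
  by case: ifPn => [iS|_]; rewrite ?mulr0// LS0 ?mulr0.
exists u; split => //; rewrite -uM; apply/matrixP => i j; rewrite !ord1.
rewrite mxE [RHS]mxE; apply: eq_bigr => k _; rewrite [M _ _]mxE.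
by case: ifPn => // kS; rewrite uN// !mul0r.
Qed.

Lemma laplacian_kernel_nonconst : (0 < N)%N -> ~ has_spanning_tree W ->
  exists x : 'cV[R]_N, laplacian W *m x = 0 /\ exists i j, x i 0 != x j 0.
Proof.
move=> N_gt0 ntree.
pose anc i := [set j | connect (Defs.arc W) j i].
have anc_refl i : i \in anc i by rewrite inE connect0.
have anc_closed k i j : i \in anc k -> Defs.arc W j i -> j \in anc k.
  by rewrite !inE => ik ji; apply: connect_trans ik; exact: connect1.
(* An [r] with fewest ancestors: each of its ancestors has the same ancestor set, hence is reachable
   from [r]. *)
have [r rmin] : exists r, forall i, (#|anc r| <= #|anc i|)%N.
  by case: (@arg_minnP _ (Ordinal N_gt0) xpredT (fun i => #|anc i|)) => //
    r _ h; exists r => i; exact: h.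
have anc_back j : j \in anc r -> r \in anc j.
  move=> jr; suff -> : anc j = anc r by [].
  apply/eqP; rewrite eqEcard rmin andbT; apply/fintype.subsetP => k.
  by rewrite !inE => kj; apply: connect_trans kj _; move: jr; rewrite inE.
have [k rk] : exists k, ~~ connect (Defs.arc W) r k.
  apply: contra_notP ntree => h; exists r => i.
  by apply: contraT => ri; case: h; exists i.
(* A common ancestor j would give a path from [r] through j to [k]. *)
have disj j : j \in anc r -> j \notin anc k.
  move=> /anc_back; rewrite !inE => rj; apply: contra rk.
  exact: connect_trans rj.
have [u [u0 uL uS]] := laplacian_left_null (anc_refl r) (@anc_closed r).
have [w [w0 wL wS]] := laplacian_left_null (anc_refl k) (@anc_closed k).
(* w annihilates this rank-one perturbation of L, whose right kernel consists
   of the vectors of ker L that vanish at r. *)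
pose M := laplacian W + u^T *m delta_mx 0 r.
have wu : w *m u^T = 0.
  apply/matrixP => i j; rewrite !ord1 !mxE big1// => l _; rewrite mxE.
  have [lr|lr] := boolP (l \in anc r); last by rewrite uS ?mulr0.
  by rewrite wS ?mul0r// disj.
have /det0P[y y0 yM] : \det M^T == 0.
  rewrite det_tr; apply/det0P; exists w => //.
  by rewrite mulmxDr wL mulmxA wu mul0mx addr0.
have Mx : M *m y^T = 0 by rewrite -[M]trmxK -trmx_mul yM trmx0.
(* Since u L = 0, u M is |u|^2 times the r-th unit row, so M y = 0 forces y_r = 0; then M y reduces
   to L y. *)
have yr : y 0 r = 0.
  have : u *m (M *m y^T) = 0 by rewrite Mx mulmx0.
  have uM : u *m M = (u *m u^T) *m delta_mx 0 r.
    by rewrite mulmxDr uL add0r mulmxA.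
  rewrite mulmxA uM -mulmxA -rowE => /matrixP/(_ 0 0)/eqP.
  rewrite mxE big_ord1 [X in _ == X]mxE mulf_eq0 => /orP[|]; last first.
    by rewrite !mxE => /eqP.
  rewrite mxE => /eqP/psumr_eq0P u2.
  case/negP: u0; apply/eqP/matrixP => i j; rewrite !ord1 [RHS]mxE.
  have /eqP : u 0 j * u^T j 0 = 0.
    by apply: u2 => // l _; rewrite mxE -expr2 sqr_ge0.
  by rewrite mxE -expr2 sqrf_eq0 => /eqP.
exists y^T; split.
  move: Mx; rewrite mulmxDl -mulmxA -rowE.
  suff -> : row r y^T = 0 by rewrite mulmx0 addr0.
  by apply/matrixP => i j; rewrite !ord1 !mxE.
(* A constant y would be zero, as its entry at [r] vanishes. *)
exists r; case: (pselect (exists j, y^T r 0 != y^T j 0)) => // h.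
case/negP: y0; apply/eqP/matrixP => i j; rewrite ord1 mxE -yr.
apply/eqP; apply: contraT => yj; case: h; exists j.
by rewrite !mxE eq_sym.
Qed.

End LaplacianAlgebra.

(** * Real and imaginary parts of complex matrices *)

Section ComplexParts.
Variable R : rcfType.

Definition Re_mx m n (A : 'M[R[i]]_(m, n)) : 'M[R]_(m, n) :=
  map_mx (@complex.Re R) A.
Definition Im_mx m n (A : 'M[R[i]]_(m, n)) : 'M[R]_(m, n) :=
  map_mx (@complex.Im R) A.
Local Notation toC := (map_mx (real_complex R)).

Lemma Re_sum I (s : seq I) (F : I -> R[i]) :
  complex.Re (\sum_(i <- s) F i) = \sum_(i <- s) complex.Re (F i).
Proof. by apply: (big_morph (@complex.Re R)) => // -[? ?] [? ?]. Qed.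

Lemma Im_sum I (s : seq I) (F : I -> R[i]) :
  complex.Im (\sum_(i <- s) F i) = \sum_(i <- s) complex.Im (F i).
Proof. by apply: (big_morph (@complex.Im R)) => // -[? ?] [? ?]. Qed.

Lemma Re_mulCl (r : R) (z : R[i]) : complex.Re (r%:C * z) = r * complex.Re z.
Proof. by case: z => x y /=; rewrite mul0r subr0. Qed.

Lemma Im_mulCl (r : R) (z : R[i]) : complex.Im (r%:C * z) = r * complex.Im z.
Proof. by case: z => x y /=; rewrite mul0r addr0. Qed.

Lemma Re_mx_mull m n p (A : 'M[R]_(m, n)) (B : 'M[R[i]]_(n, p)) :
  Re_mx (toC A *m B) = A *m Re_mx B.
Proof.
apply/matrixP => i j; rewrite !mxE Re_sum; apply: eq_bigr => k _.
by rewrite !mxE Re_mulCl.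
Qed.

Lemma Im_mx_mull m n p (A : 'M[R]_(m, n)) (B : 'M[R[i]]_(n, p)) :
  Im_mx (toC A *m B) = A *m Im_mx B.
Proof.
apply/matrixP => i j; rewrite !mxE Im_sum; apply: eq_bigr => k _.
by rewrite !mxE Im_mulCl.
Qed.

Lemma Re_mx_mulr m n p (B : 'M[R[i]]_(m, n)) (A : 'M[R]_(n, p)) :
  Re_mx (B *m toC A) = Re_mx B *m A.
Proof.
apply/matrixP => i j; rewrite !mxE Re_sum; apply: eq_bigr => k _.
by rewrite !mxE mulrC Re_mulCl mulrC.
Qed.

Lemma Im_mx_mulr m n p (B : 'M[R[i]]_(m, n)) (A : 'M[R]_(n, p)) :
  Im_mx (B *m toC A) = Im_mx B *m A.
Proof.
apply/matrixP => i j; rewrite !mxE Im_sum; apply: eq_bigr => k _.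
by rewrite !mxE mulrC Im_mulCl mulrC.
Qed.

Lemma Re_mx_toC m n (A : 'M[R]_(m, n)) : Re_mx (toC A) = A.
Proof. by apply/matrixP => i j; rewrite !mxE. Qed.

Lemma Re_mxBZ m n (A B : 'M[R[i]]_(m, n)) (l : R[i]) :
  Re_mx (A - l *: B) =
    Re_mx A - (complex.Re l *: Re_mx B - complex.Im l *: Im_mx B).
Proof.
apply/matrixP => i j; rewrite !mxE.
by case: l (A i j) (B i j) => [? ?] [? ?] [? ?] /=.
Qed.

Lemma Im_mxBZ m n (A B : 'M[R[i]]_(m, n)) (l : R[i]) :
  Im_mx (A - l *: B) =
    Im_mx A - (complex.Re l *: Im_mx B + complex.Im l *: Re_mx B).
Proof.
apply/matrixP => i j; rewrite !mxE.
by case: l (A i j) (B i j) => [? ?] [? ?] [? ?] /=.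
Qed.

Lemma Re_shift (a f : R) (l : R[i]) :
  complex.Re (a%:C - l * f%:C) = a - f * complex.Re l.
Proof. by case: l => x y /=; rewrite mulr0 subr0 mulrC. Qed.

End ComplexParts.

(** * Generalized kernel of the Laplacian over the complex numbers *)

Section ComplexLaplacian.
Variables (R : realType).
Local Notation toC := (map_mx (real_complex R)).

Lemma laplacianC_const N (W : 'M[R]_N) (c : R[i]) :
  toC (laplacian W) *m (const_mx c : 'cV_N) = 0.
Proof.
have -> : const_mx c = c *: toC (const_mx 1 : 'cV[R]_N).
  by apply/matrixP => i j; rewrite !mxE mulr1.
by rewrite -scalemxAr -map_mxM laplacian_const map_mx0 scaler0.
Qed.

Lemma spanning_tree_laplacianC_const N (W : 'M[R]_N)
    (W_ge0 : forall i j, 0 <= W i j) (z : 'cV_N) (c : R[i]) :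
  has_spanning_tree W ->
  (forall i, (toC (laplacian W) *m z) i 0 = c) ->
  c = 0 /\ forall i j, z i 0 = z j 0.
Proof.
move=> tree Lzc.
have [i|Rec Rez] := spanning_tree_laplacian_const W_ge0 (x := Re_mx z)
    (c := complex.Re c) tree.
  by rewrite -Re_mx_mull mxE Lzc.
have [i|Imc Imz] := spanning_tree_laplacian_const W_ge0 (x := Im_mx z)
    (c := complex.Im c) tree.
  by rewrite -Im_mx_mull mxE Lzc.
split; first by apply/eqP; rewrite eq_complex Rec Imc !eqxx.
move=> i j; apply/eqP; rewrite eq_complex.
by have := Rez i j; have := Imz i j; rewrite !mxE => -> ->; rewrite !eqxx.
Qed.

(** If L^m (L z) = 0, then L z is constant by induction, and a constant image forces z itself to be
    constant. *)
Lemma spanning_tree_laplacianC_pow n (W : 'M[R]_n.+1)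
    (W_ge0 : forall i j, 0 <= W i j) (m : nat) (z : 'cV_n.+1) :
  has_spanning_tree W -> toC (laplacian W) ^+ m *m z = 0 ->
  forall i j, z i 0 = z j 0.
Proof.
move=> tree; elim: m z => [|m IH] z.
  by rewrite expr0 mul1mx => -> i j; rewrite !mxE.
rewrite exprSr -[_ * _]/(_ *m _) -mulmxA => /IH Lz.
by have [_] := spanning_tree_laplacianC_const W_ge0 tree (Lz^~ 0).
Qed.

(** The columns of the evaluated polynomial lie in the generalized kernel of L, so each is constant
    and its entries i and j agree. *)
Lemma spanning_tree_rows_eq n (W : 'M[R]_n.+1)
    (W_ge0 : forall i j, 0 <= W i j) (lam : 'I_n.+1 -> R[i]) (i j : 'I_n.+1) :
  has_spanning_tree W -> eigenvalues_with_mult (laplacian W) lam ->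
  (delta_mx 0 i - delta_mx 0 j : 'rV_n.+1) *m
    horner_mx (toC (laplacian W))
      (\prod_(l <- [seq lam k | k <- enum 'I_n.+1 & lam k != 0]) ('X - l%:P)) = 0.
Proof.
move=> tree hlam; set A := toC _; set Q := horner_mx _ _.
(* Cayley-Hamilton, with the factors of the zero eigenvalues gathered into a power of X. *)
have AQ : exists m, A ^+ m *m Q = 0.
  have := Cayley_Hamilton A; rewrite hlam (bigID (fun k => lam k == 0))/= rmorphM/=.
  rewrite (eq_bigr (fun=> 'X)); last by move=> k /eqP ->; rewrite subr0.
  rewrite prodr_const rmorphXn/= horner_mx_X => AQ; eexists; rewrite -[RHS]AQ.
  congr (_ *m _); rewrite /Q big_map big_filter big_enum_cond/=.
  by [].
have [m {}AQ] := AQ.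
apply/matrixP => r k; rewrite ord1 mulmxBl -!rowE !mxE.
have Qk : A ^+ m *m col k Q = 0 by rewrite !colE mulmxA AQ mul0mx.
have := spanning_tree_laplacianC_pow W_ge0 tree Qk i j; rewrite !mxE => ->.
by rewrite subrr.
Qed.

End ComplexLaplacian.

(** * Decay for stable equations with vanishing forcing *)

Section StableScalarODE.
Local Open Scope classical_set_scope.
Local Open Scope ring_scope.
Variable R : realType.
Implicit Types (k r p q G : R -> R) (s t : R).

Lemma within_continuousM (A : set R) (g h : R -> R) :
  {within A, continuous g} -> {within A, continuous h} ->
  {within A, continuous (g \* h)}.
Proof. by move=> cg ch x; apply: cvgM; [exact: cg|exact: ch]. Qed.

(** Induction on the exceptional points: the interval is split at each one inside it, and continuity
    there glues the two halves. *)
Lemma nincr_off_finite (E : seq R) k s t : s <= t ->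
  {within `[s, t], continuous k} ->
  (forall x, x \in `]s, t[ -> x \notin E ->
    exists2 d, is_derive x 1 k d & d <= 0) ->
  k t <= k s.
Proof.
elim: E s t => [|e E IH] s t st ck dk.
  apply: (@ler0_derive1_nincr _ k s t) => // x xst.
    by have [d dx _] := dk x xst isT; exact: ex_derive.
  by have [d dx d0] := dk x xst isT; rewrite derive1E derive_val.
have [|est] := boolP (e \in `]s, t[); last first.
  apply: IH => // x xst xE; apply: dk => //.
  by rewrite inE negb_or xE andbT; apply: contraNneq est => <-.
rewrite in_itv/= => /andP[se et].
have sub1 : (`[s, e] `<=` `[s, t]).
  by apply: subset_itvl; rewrite bnd_simp ltW.
have sub2 : (`[e, t] `<=` `[s, t]).
  by apply: subset_itvr; rewrite bnd_simp ltW.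
apply: (@le_trans _ _ (k e)).
- apply: (IH e t (ltW et)).
    exact: (continuous_subspaceW sub2 ck).
  move=> x; rewrite in_itv/= => /andP[ex xt] xE; apply: dk.
    by rewrite in_itv/= (lt_trans se ex).
  by rewrite inE negb_or xE gt_eqF.
- apply: (IH s e (ltW se)).
    exact: (continuous_subspaceW sub1 ck).
  move=> x; rewrite in_itv/= => /andP[sx xe] xE; apply: dk.
    by rewrite in_itv/= sx (lt_trans xe et).
  by rewrite inE negb_or xE lt_eqF.
Qed.

(** Same shape as the first clause of [piecewise_continuous], so it applies directly to the
    discontinuities of v. *)
Definition locally_finite (E : set R) :=
  forall T, finite_set [set t | 0 < t <= T /\ E t].

(** Once G < c e/2, the inequality becomes (r - e/2)' <= -c (r - e/2), so r eventually falls below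
    e. *)
Lemma cvg0_of_damped (E : set R) (c : R) r G : 0 < c ->
  locally_finite E ->
  {within `[0, +oo[, continuous r} ->
  (forall t, 0 < t -> ~ E t ->
    exists2 d, is_derive t 1 r d & d <= - c * r t + G t) ->
  (forall t, 0 <= t -> 0 <= r t) ->
  (G t @[t --> +oo] --> (0 : R)) ->
  (r t @[t --> +oo] --> (0 : R)).
Proof.
move=> c0 Efin cr dr r0 G0.
apply/cvgr0Pnorm_lt => e e0.
have ec0 : 0 < e / 2 * c by rewrite mulr_gt0// divr_gt0.
have [T [_ TG]] : exists T, T \is Num.real /\ forall t, T < t -> `|G t| < e / 2 * c.
  by have [T [? ?]] := @cvgr0_norm_lt _ _ _ _ _ G G0 _ ec0; exists T.
pose s := Num.max T 0 + 1.
have Ts : T < s by rewrite ltr_pwDr// le_max lexx.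
have s0 : 0 < s by rewrite ltr_pwDr// le_max lexx orbT.
(* e^(ct) (r - e/2) is nonincreasing on [s, +oo[. *)
pose k t := expR (c * t) * (r t - e / 2).
have kle t : s <= t -> k t <= k s.
  move=> st.
  have /finite_seqP[F FE] := Efin t.
  have FP x : x \in `]s, t[ -> x \notin F -> 0 < x /\ ~ E x.
    rewrite in_itv/= => /andP[sx xt] xF; have x0 := lt_trans s0 sx; split=> // Ex.
    case/negP: xF; have : [set` F] x by rewrite -FE/= x0 (ltW xt).
    by [].
  apply: (@nincr_off_finite F k) => //.
  - have sub : (`[s, t] `<=` `[0, +oo[).
      move=> x /=; rewrite !in_itv/= andbT => /andP[sx _].
      exact: le_trans (ltW s0) sx.
    apply: (@within_continuousM _ (fun t => expR (c * t)) (fun t => r t - e / 2)).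
      apply: continuous_subspaceT => y.
      apply: continuous_comp; last exact: continuous_expR.
      by apply: cvgM; [exact: cvg_cst|exact: cvg_id].
    apply: within_continuousB; first exact: (continuous_subspaceW sub cr).
    by apply: continuous_subspaceT => y; exact: cvg_cst.
  - move=> x xst xF; have [x0 nEx] := FP x xst xF.
    have [d dx dle] := dr x x0 nEx.
    exists (expR (c * x) * (d + c * r x - e / 2 * c)).
      rewrite /k; apply: is_derive_eq.
      by rewrite /GRing.scale/=; ring.
    rewrite pmulr_rle0 ?expR_gt0//.
    have /TG : T < x by move: xst; rewrite in_itv/= => /andP[+ _]; exact: lt_trans.
    by rewrite ltr_norml => /andP[_]; move: dle; lra.
near=> t.
have st : s <= t by near: t; apply: nbhs_pinfty_ge; rewrite num_real.
rewrite ger0_norm ?r0 ?(le_trans (ltW s0))//.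
have := kle t st; rewrite {1}/k => h.
have E0 := expR_gt0 (c * t).
(* By e^(ct) >= 1 + ct, the right side outgrows the fixed number [k s]. *)
have kt : k s < expR (c * t) * (e / 2).
  apply: (@lt_le_trans _ _ ((1 + c * t) * (e / 2))); last first.
    by rewrite ler_wpM2r ?expR_ge1Dx// divr_ge0// ltW.
  have : k s / (c * (e / 2)) < t.
    by near: t; apply: nbhs_pinfty_gt; rewrite num_real.
  rewrite ltr_pdivrMr ?mulr_gt0 ?divr_gt0// => /lt_le_trans; apply.
  have := ltW e0; nra.
have : expR (c * t) * (r t - e / 2) < expR (c * t) * (e / 2).
  exact: le_lt_trans kt.
by rewrite ltr_pM2l//; lra.
Unshelve. all: by end_near. Qed.

(* p + iq solves z' = (al + i be) z + (g1 + i g2). *)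
Lemma cvg0_of_stable_planar (E : set R) (al be : R) p q (g1 g2 : R -> R) :
  al < 0 -> locally_finite E ->
  {within `[0, +oo[, continuous p} ->
  {within `[0, +oo[, continuous q} ->
  (forall t, 0 < t -> ~ E t -> is_derive t 1 p (al * p t - be * q t + g1 t)) ->
  (forall t, 0 < t -> ~ E t -> is_derive t 1 q (be * p t + al * q t + g2 t)) ->
  (g1 t @[t --> +oo] --> (0 : R)) ->
  (g2 t @[t --> +oo] --> (0 : R)) ->
  (p t @[t --> +oo] --> (0 : R)) /\ (q t @[t --> +oo] --> (0 : R)).
Proof.
move=> al0 Efin cp cq dp dq g10 g20.
(* In the derivative of the squared modulus r the rotation terms in [be] cancel, leaving 2 al r plus
   cross terms with the forcing; AM-GM spends half of the damping on the latter. *)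
have r0 : ((p t ^+ 2 + q t ^+ 2) @[t --> +oo] --> (0 : R)).
  pose c := - al.
  have c0 : 0 < c by rewrite oppr_gt0.
  apply: (@cvg0_of_damped E c (fun t => p t ^+ 2 + q t ^+ 2)
    (fun t => c^-1 * (g1 t * g1 t + g2 t * g2 t))) => //.
  - apply: (@within_continuousD _ _ _ _ (fun t => p t ^+ 2) (fun t => q t ^+ 2)).
      exact: (within_continuousM cp cp).
    exact: (within_continuousM cq cq).
  - move=> t t0 nE; have dpt := dp t t0 nE; have dqt := dq t t0 nE.
    exists (2 * (p t * (al * p t - be * q t + g1 t) +
                 q t * (be * p t + al * q t + g2 t))).
      apply: (@is_derive_eq _ _ _ (p ^+ 2 + q ^+ 2)).
      by rewrite /GRing.scale/=; ring.
    (* AM-GM: 2 p g <= c p^2 + g^2 / c *)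
    have amgm x y : 2 * (x * y) <= c * (x * x) + c^-1 * (y * y).
      rewrite -subr_ge0 (_ : _ - _ = c^-1 * (c * x - y) ^+ 2); last by field; lra.
      by rewrite mulr_ge0 ?sqr_ge0// invr_ge0 ltW.
    have := amgm (p t) (g1 t); have := amgm (q t) (g2 t); rewrite /c; lra.
  - by move=> t _; rewrite addr_ge0 ?sqr_ge0.
  - have -> : 0 = c^-1 * (0 * 0 + 0 * 0) by ring.
    by apply: cvgM; [exact: cvg_cst|apply: cvgD; exact: cvgM].
suff sqr_cvg (y : R -> R) : (forall t, y t ^+ 2 <= p t ^+ 2 + q t ^+ 2) ->
    (y t @[t --> +oo] --> (0 : R)).
  by split; apply: sqr_cvg => t; rewrite ?lerDl ?lerDr sqr_ge0.
move=> ley; apply/cvgr0Pnorm_lt => e e0.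
have e20 : 0 < e ^+ 2 by rewrite exprn_gt0.
near=> t.
rewrite -(@ltr_pXn2r _ 2%N) ?nnegrE// 1?ltW// real_normK ?num_real//.
apply: le_lt_trans (ley t) (le_lt_trans (ler_norm _) _).
near: t; exact: cvgr0_norm_lt.
Unshelve. all: by end_near. Qed.

End StableScalarODE.

(** * Piecewise continuous inputs and existence of a forced scalar solution *)

Section PiecewiseContinuous.
Local Open Scope classical_set_scope.
Local Open Scope ring_scope.
Variable R : realType.
Implicit Types v g : R -> R.

(** The one-sided limits bound v near each point, and compactness of [0, T] makes the bound
    uniform. *)
Lemma piecewise_continuous_bounded v (T : R) : piecewise_continuous v ->
  exists M : R, forall t, 0 <= t <= T -> `|v t| <= M.
Proof.
move=> [_ vr vl].
pose P (M t : R) := 0 <= t -> `|v t| <= M.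
have [|M [_ MP]] := (@compact_near_coveringP _ _).1 (@segment_compact R 0 T) R
    (pinfty_nbhs R) P _ ; last first.
  have MM1 : M < M + 1 by rewrite ltrDl.
  exists (M + 1) => t t0T; have [t0 _] := andP t0T.
  by apply: (MP (M + 1) MM1 t _ t0); rewrite /= in_itv.
move=> x; rewrite /= in_itv/= => /andP[x0 _].
suff [M Mx] : exists M : R, \forall y \near x, P M y.
  exists ([set y | P M y], [set M' | M <= M']).
    by split => //=; apply: nbhs_pinfty_ge; rewrite num_real.
  by move=> [y M'] /= [PMy MM'] y0; exact: le_trans (PMy y0) MM'.
have cvg_bound (F : set_system R) : Filter F -> cvg (v @ F) ->
    exists M : R, \forall y \near F, `|v y| <= M.
  move=> FF /cvg_ex[l vl']; exists (`|l| + 1).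
  have ll1 : `|l| < `|l| + 1 by rewrite ltrDl.
  exact: (@cvgr_norm_le _ _ _ F _ v l vl' _ ll1).
have [Mr Mrx] := cvg_bound _ _ (vr x x0).
have [Ml Mlx] : exists M : R, \forall y \near x^'-, 0 <= y -> `|v y| <= M.
  (* No left limit is assumed at 0; points to its left are negative, where the guarded bound claims
     nothing. *)
  move: x0; rewrite le_eqVlt => /predU1P[<-|x0].
    exists 0; near=> y => y0; have : y < 0 by near: y; exact: nbhs_left_lt.
    by rewrite ltNge y0.
  have [M Mx] := cvg_bound _ _ (vl x x0).
  by exists M; near do move=> _.
exists (Num.max `|v x| (Num.max Mr Ml)).
move: Mrx Mlx; rewrite !near_withinE => Mrx Mlx.
near=> y => y0; rewrite !le_max.
have [yx|yx|->] := ltgtP y x; last by rewrite lexx.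
- suff -> : `|v y| <= Ml by rewrite !orbT.
  by move: y0; apply: (near Mlx y).
- suff -> : `|v y| <= Mr by rewrite !orbT.
  exact: (near Mrx y).
Unshelve. all: by end_near. Qed.

Lemma piecewise_continuous_integrable v (T : R) : piecewise_continuous v ->
  lebesgue_measure.-integrable `[0, T] (EFin \o v).
Proof.
move=> pcv; have [M vM] := piecewise_continuous_bounded T pcv.
have [/(_ T) vfin _ _] := pcv.
apply: measurable_bounded_integrable => //.
- by rewrite /= lebesgue_measure_itv/=; case: ifP; rewrite ?ltry.
- set F := [set t : R | _] in vfin.
  (* Away from the finite set [B] of discontinuities and endpoints, v is continuous on an open set;
     every subset of [B] is measurable. *)
  pose B := (F `|` [set 0; T]).
  have finB : finite_set B by rewrite finite_setU; split=> //; exact: finite_set2.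
  have cB : closed B.
    exact: (accessible_finite_set_closed.1 (hausdorff_accessible (@Rhausdorff R))).
  have mB A : A `<=` B -> measurable A.
    move=> AB; apply: countable_measurable; first exact: measurable_set1.
    exact: finite_set_countable (sub_finite_set AB finB).
  have oD : open (`]0, T[ `\` B).
    rewrite setDE; apply: openI; first exact: interval_open.
    exact: closed_openC.
  have mD : measurable (`]0, T[ `\` B) by exact: open_measurable.
  apply: (@measurable_funS _ _ _ _ ((`]0, T[ `\` B) `|` B)).
  + by apply: measurableU => //; exact: mB.
  + move=> t /=; rewrite !in_itv/= => /andP[t0 tT].
    have [Bt|nBt] := pselect (B t); [by right|left; split=> //].
    by rewrite !lt_neqAle t0 tT !andbT; apply/andP; split; apply/eqP => tE;
      apply: nBt; right; [left|right]; rewrite tE.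
  + apply/measurable_funU => //; first exact: mB.
    split; last by move=> _ Y _; apply: mB => ? [].
    apply: open_continuous_measurable_fun => // t; rewrite inE => -[/= t0T nBt].
    apply: contrapT => nc; apply: nBt; left; split=> //.
    by move: t0T; rewrite in_itv/= => /andP[-> /ltW].
- exists M; split; first exact: num_real.
  move=> M' MM' t; rewrite /= in_itv/= => t0T.
  by rewrite (le_trans (vM t t0T))// ltW.
Qed.

Lemma piecewise_continuousM v g : continuous g ->
  piecewise_continuous v -> piecewise_continuous (fun t => g t * v t).
Proof.
move=> cg [vfin vr vl]; split.
- move=> T; apply: sub_finite_set (vfin T) => t /= [t0T nc]; split=> // cv.
  by apply: nc; apply: cvgM; [exact: cg|exact: cv].
- move=> t t0; have /cvg_ex[l vl'] := vr t t0; apply/cvg_ex; exists (g t * l).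
  by apply: cvgM => //; apply: cvg_at_right_filter; exact: cg.
- move=> t t0; have /cvg_ex[l vl'] := vl t t0; apply/cvg_ex; exists (g t * l).
  by apply: cvgM => //; apply: cvg_at_left_filter; exact: cg.
Qed.

Lemma piecewise_continuous_primitive v : piecewise_continuous v ->
  exists2 V : R -> R, {within `[0, +oo[, continuous V} &
    forall t, 0 < t -> {for t, continuous v} -> is_derive t 1 V (v t).
Proof.
move=> pcv; have intv T := piecewise_continuous_integrable T pcv.
exists (fun t => parameterized_integral lebesgue_measure 0 t v); last first.
  move=> t t0 ct.
  (* Integrating up to t + 1 puts t in the interior, where the fundamental theorem applies. *)
  have tt1 : t < t + 1 by rewrite ltrDl.
  have [dV V'] := continuous_FTC1_closed tt1 (intv _) t0 ct.
  by apply: DeriveDef => //; rewrite -V' derive1E.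
have cV T : 0 < T -> {within `[0, T],
    continuous (fun t => parameterized_integral lebesgue_measure 0 t v)}.
  by move=> T0; exact: parameterized_integral_continuous (ltW T0) (intv T).
(* Interior points t are handled on [0, t + 1], the endpoint 0 on [0, 1]. *)
apply/continuous_within_itvcyP; split.
  move=> t; rewrite in_itv/= andbT => t0.
  have t10 : 0 < t + 1 by rewrite addr_gt0.
  have /(continuous_within_itvP _ t10)[+ _ _] := cV _ t10.
  by apply; rewrite in_itv/= t0/= ltrDl.
by have /(continuous_within_itvP _ ltr01)[_ + _] := cV 1 ltr01.
Qed.

(** Variation of constants: y is e^(at) times a primitive of e^(-at) b v. Necessity needs such an
    actual solution on which to test consensus. *)
Lemma linear_ode_solution (a b : R) v : piecewise_continuous v ->
  exists2 y : R -> R, {within `[0, +oo[, continuous y} &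
    forall t, 0 < t -> {for t, continuous v} ->
      is_derive t 1 y (a * y t + b * v t).
Proof.
move=> pcv.
have cexp (c : R) : continuous (fun t : R => expR (c * t)).
  move=> t; apply: continuous_comp; last exact: continuous_expR.
  by apply: cvgM; [exact: cvg_cst|exact: cvg_id].
have cg : continuous (fun t : R => expR (- a * t) * b).
  by move=> t; apply: cvgM; [exact: cexp|exact: cvg_cst].
have [V cV dV] := piecewise_continuous_primitive (piecewise_continuousM cg pcv).
exists (fun t => expR (a * t) * V t).
  apply: within_continuousM cV.
  exact: continuous_subspaceT (cexp a).
move=> t t0 ct.
have dVt : is_derive t 1 V (expR (- a * t) * b * v t).
  by apply: dV => //; apply: cvgM; [exact: cg|exact: ct].
apply: is_derive_eq.
rewrite /GRing.scale/= !mulrA -expRD mulNr subrr expR0.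
by ring.
Qed.

End PiecewiseContinuous.

(** * Linear functionals of a solution and the decay of one mode *)

Section Sufficiency.
Local Open Scope classical_set_scope.
Local Open Scope ring_scope.
Variables (R : realType) (N : nat) (W : 'M[R]_N) (a f b : R) (v : R -> R).
Variable x : 'I_N -> R -> R.
Local Notation toC := (map_mx (real_complex R)).
Local Notation L := (laplacian W).
Hypothesis v_pc : piecewise_continuous v.
Hypothesis x_sol : is_solution a f b W v x.

Let X t : 'cV[R]_N := \col_i x i t.

(** Rewritten as a linear combination of functions, the functional falls under the sum rules for
    continuity and derivatives. *)
Let functional_sum (c : 'rV[R]_N) :
  (fun t => (c *m X t) 0 0) = \sum_j (c 0 j *: x j).
Proof.
apply/funext => t; rewrite mxE fct_sumE.
by apply: eq_bigr => j _; rewrite mxE.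
Qed.

Lemma functionalE (c : 'rV[R]_N) t : (c *m X t) 0 0 = \sum_j c 0 j * x j t.
Proof. by rewrite mxE; apply: eq_bigr => j _; rewrite mxE. Qed.

Lemma functional_continuous (c : 'rV[R]_N) :
  {within `[0, +oo[, continuous (fun t => (c *m X t) 0 0)}.
Proof.
rewrite functional_sum; elim/big_ind : _ => [|g h cg ch|j _].
- by apply: continuous_subspaceT => t; exact: cvg_cst.
- exact: within_continuousD.
- apply: (@within_continuousM _ _ (cst (c 0 j)) (x j)); last by case: (x_sol j).
  by apply: continuous_subspaceT => t; exact: cvg_cst.
Qed.

(* The common input b v cancels because c kills the constants. *)
Lemma functional_is_derive (c : 'rV[R]_N) t : c *m const_mx 1 = 0 :> 'M[R]_1 ->
  0 < t -> {for t, continuous v} ->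
  is_derive t 1 (fun t => (c *m X t) 0 0)
    (a * (c *m X t) 0 0 - f * (c *m L *m X t) 0 0).
Proof.
move=> c1 t0 ct.
rewrite functional_sum.
have dx j : is_derive t 1 (x j)
    (a * x j t + f * (\sum_k W j k * (x k t - x j t)) + b * v t).
  by have [_] := x_sol j; apply.
apply: is_derive_eq.
have -> : \sum_j c 0 j *:
      (a * x j t + f * (\sum_k W j k * (x k t - x j t)) + b * v t)
    = \sum_j (a * (c 0 j * x j t) - f * (c 0 j * (L *m X t) j 0) + b * v t * c 0 j).
  apply: eq_bigr => j _; rewrite laplacian_mul_col /GRing.scale/=.
  have -> : \sum_k W j k * (x k t - x j t) =
      - \sum_k W j k * (X t j 0 - X t k 0).
    by rewrite -sumrN; apply: eq_bigr => k _; rewrite !mxE; ring.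
  by ring.
rewrite big_split/= sumrB -!mulr_sumr -mulmxA functionalE.
have -> : \sum_j c 0 j = 0.
  transitivity ((c *m const_mx 1 : 'M[R]_1) 0 0); last by rewrite c1 mxE.
  by rewrite mxE; apply: eq_bigr => j _; rewrite mxE mulr1.
by rewrite mulr0 addr0 [(c *m (L *m _)) _ _]mxE.
Qed.

(** From w L = l w + w', the function z = w x satisfies z' = (a - f l) z - f w' x; its real and
    imaginary parts form a stable planar system with vanishing forcing. *)
Lemma functional_cvg0_step (l : R[i]) (w : 'rV[R[i]]_N) :
  complex.Re (a%:C - l * f%:C) < 0 -> w *m const_mx 1 = 0 :> 'M[R[i]]_1 ->
  let w' := w *m toC L - l *: w in
  (Re_mx w' *m X t) 0 0 @[t --> +oo] --> (0 : R) ->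
  (Im_mx w' *m X t) 0 0 @[t --> +oo] --> (0 : R) ->
  (Re_mx w *m X t) 0 0 @[t --> +oo] --> (0 : R) /\
  (Im_mx w *m X t) 0 0 @[t --> +oo] --> (0 : R).
Proof.
rewrite Re_shift => stable w1 w' Rew0 Imw0.
have const1 : (const_mx 1 : 'cV[R[i]]_N) = toC (const_mx 1).
  by apply/matrixP => i j; rewrite !mxE.
have Rew1 : Re_mx w *m const_mx 1 = 0 :> 'M[R]_1.
  by rewrite -Re_mx_mulr -const1 w1; apply/matrixP => i j; rewrite !mxE.
have Imw1 : Im_mx w *m const_mx 1 = 0 :> 'M[R]_1.
  by rewrite -Im_mx_mulr -const1 w1; apply/matrixP => i j; rewrite !mxE.
have ReL : Re_mx w *m L =
    Re_mx w' + (complex.Re l *: Re_mx w - complex.Im l *: Im_mx w).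
  by rewrite Re_mxBZ Re_mx_mulr subrK.
have ImL : Im_mx w *m L =
    Im_mx w' + (complex.Re l *: Im_mx w + complex.Im l *: Re_mx w).
  by rewrite Im_mxBZ Im_mx_mulr subrK.
have [vfin _ _] := v_pc.
have opp0 (g : R -> R) : g t @[t --> +oo] --> (0 : R) ->
    - f * g t @[t --> +oo] --> (0 : R).
  move=> g0; have : - f * g t @[t --> +oo] --> - f * 0.
    by apply: cvgM => //; exact: cvg_cst.
  by rewrite mulr0.
pose p (t : R) : R := (Re_mx w *m X t) 0 0.
pose q (t : R) : R := (Im_mx w *m X t) 0 0.
have cp : {within `[0, +oo[, continuous p} by exact: functional_continuous.
have cq : {within `[0, +oo[, continuous q} by exact: functional_continuous.
pose al := a - f * complex.Re l; pose be := - (f * complex.Im l).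
(* The exceptional set is the set of discontinuities, itself a negation, hence the double
   negation. *)
have dp t : 0 < t -> ~ ~ {for t, continuous v} ->
    is_derive t 1 p (al * p t - be * q t + - f * (Re_mx w' *m X t) 0 0).
  move=> t0 /contrapT ct.
  have := functional_is_derive Rew1 t0 ct; rewrite ReL => dw.
  apply: is_derive_eq; rewrite !(mulmxDl, mulNmx) -!scalemxAl.
  by rewrite ![fun_of_matrix (_ + _) _ _]mxE ![fun_of_matrix (- _) _ _]mxE
    ![fun_of_matrix (_ *: _) _ _]mxE /p /q /al /be; ring.
have dq t : 0 < t -> ~ ~ {for t, continuous v} ->
    is_derive t 1 q (be * p t + al * q t + - f * (Im_mx w' *m X t) 0 0).
  move=> t0 /contrapT ct.
  have := functional_is_derive Imw1 t0 ct; rewrite ImL => dw.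
  apply: is_derive_eq; rewrite !mulmxDl -!scalemxAl.
  by rewrite ![fun_of_matrix (_ + _) _ _]mxE
    ![fun_of_matrix (_ *: _) _ _]mxE /p /q /al /be; ring.
exact: (@cvg0_of_stable_planar _ [set t | ~ {for t, continuous v}] al be p q _ _
  stable vfin cp cq dp dq
  (opp0 _ Rew0) (opp0 _ Imw0)).
Qed.

End Sufficiency.

(** * Iterating the decay step, and modal solutions for necessity *)

Section Consensus.
Local Open Scope classical_set_scope.
Local Open Scope ring_scope.
Variable R : realType.
Implicit Types (a f b : R) (v : R -> R).
Local Notation toC := (map_mx (real_complex R)).

(** Induction on the factors, for all w at once: w (L - l) still kills the constants because L does,
    and it is killed by the remaining product. *)
Lemma functional_cvg0 n (W : 'M[R]_n.+1) a f b v (x : 'I_n.+1 -> R -> R)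
    (s : seq R[i]) (w : 'rV[R[i]]_n.+1) :
  piecewise_continuous v -> is_solution a f b W v x ->
  (forall l, l \in s -> complex.Re (a%:C - l * f%:C) < 0) ->
  w *m const_mx 1 = 0 :> 'M[R[i]]_1 ->
  w *m horner_mx (toC (laplacian W)) (\prod_(l <- s) ('X - l%:P)) = 0 ->
  (Re_mx w *m \col_i x i t) 0 0 @[t --> +oo] --> (0 : R) /\
  (Im_mx w *m \col_i x i t) 0 0 @[t --> +oo] --> (0 : R).
Proof.
move=> v_pc x_sol; elim: s w => [|l s IH] w stable w1.
  rewrite big_nil rmorph1 mulmx1 => ->.
  have -> : Re_mx (0 : 'rV[R[i]]_n.+1) = 0 by apply/matrixP => i j; rewrite !mxE.
  have -> : Im_mx (0 : 'rV[R[i]]_n.+1) = 0 by apply/matrixP => i j; rewrite !mxE.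
  by split; under eq_fun do rewrite mul0mx mxE; exact: cvg_cst.
rewrite big_cons rmorphM/= -[_ * _]/(_ *m _) mulmxA => wp.
have w'E : w *m horner_mx (toC (laplacian W)) ('X - l%:P) =
    w *m toC (laplacian W) - l *: w.
  by rewrite rmorphB/= horner_mx_X horner_mx_C mulmxBr mul_mx_scalar.
rewrite w'E in wp.
have [] := IH (w *m toC (laplacian W) - l *: w).
- by move=> k ks; apply: stable; rewrite inE ks orbT.
- by rewrite mulmxBl -mulmxA laplacianC_const mulmx0 -scalemxAl w1 scaler0 subr0.
- exact: wp.
exact: (functional_cvg0_step v_pc x_sol (stable l (mem_head _ _)) w1).
Qed.

Lemma consensus_of_stable n (W : 'M[R]_n.+1) a f b v (lam : 'I_n.+1 -> R[i]) :
  (forall i j, 0 <= W i j) -> piecewise_continuous v ->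
  eigenvalues_with_mult (laplacian W) lam -> has_spanning_tree W ->
  (forall i, lam i != 0 -> complex.Re (a%:C - lam i * f%:C) < 0) ->
  achieves_consensus a f b W v.
Proof.
move=> W_ge0 v_pc hlam tree stable x0 x x_sol _ i j.
(* The functional [d] reads off x_i - x_j; as it is real, only the real-part limit is kept. *)
pose d : 'rV[R]_n.+1 := delta_mx 0 i - delta_mx 0 j.
have dC : toC d = delta_mx 0 i - delta_mx 0 j by rewrite map_mxB !map_delta_mx.
have [|||+ _] := functional_cvg0 (w := toC d)
    (s := [seq lam k | k <- enum 'I_n.+1 & lam k != 0]) v_pc x_sol.
- by move=> l /mapP[k]; rewrite mem_filter => /andP[lk _] ->; exact: stable.
- by rewrite dC mulmxBl -!rowE; apply/matrixP => k l; rewrite !mxE subrr.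
- by rewrite dC; exact: spanning_tree_rows_eq.
rewrite Re_mx_toC; under eq_fun do rewrite /d mulmxBl -!rowE !mxE.
exact.
Qed.

(* With [z = p + iq], the solution is the real part of [e^((al + i be) t) z]. *)
Lemma eigenvector_is_solution N (W : 'M[R]_N) a f b v (y : R -> R)
    (z : 'cV[R[i]]_N) (l : R[i]) :
  {within `[0, +oo[, continuous y} ->
  (forall t, 0 < t -> {for t, continuous v} ->
    is_derive t 1 y (a * y t + b * v t)) ->
  toC (laplacian W) *m z = l *: z ->
  let al := a - f * complex.Re l in let be := - (f * complex.Im l) in
  is_solution a f b W v (fun i t => y t + expR (al * t) *
    (complex.Re (z i 0) * cos (be * t) - complex.Im (z i 0) * sin (be * t))).
Proof.
move=> cy dy Lz al be.
pose p i := complex.Re (z i 0); pose q i := complex.Im (z i 0).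
pose h i (t : R) : R := expR (al * t) * (p i * cos (be * t) - q i * sin (be * t)).
have dh i (t : R) : is_derive t 1 (h i) (al * h i t -
    be * (expR (al * t) * (p i * sin (be * t) + q i * cos (be * t)))).
  rewrite /h; apply: is_derive_eq.
  by rewrite /GRing.scale/=; ring.
have ch i : continuous (h i).
  move=> t; apply: differentiable_continuous; apply/derivable1_diffP.
  by have := dh i t => ?; exact: ex_derive.
(* [Lp] and [Lq] are the real and imaginary parts of L z = l z; the coupling sum is minus the
   Laplacian. *)
have Lp i : \sum_j W i j * (p j - p i) = - (complex.Re l * p i - complex.Im l * q i).
  have <- : Re_mx (l *: z) i 0 = complex.Re l * p i - complex.Im l * q i.
    by rewrite !mxE /p /q; case: (l) (z i 0) => [? ?] [? ?].
  rewrite -Lz Re_mx_mull laplacian_mul_col -sumrN; apply: eq_bigr => j _.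
  by rewrite !mxE -mulrN opprB.
have Lq i : \sum_j W i j * (q j - q i) = - (complex.Re l * q i + complex.Im l * p i).
  have <- : Im_mx (l *: z) i 0 = complex.Re l * q i + complex.Im l * p i.
    by rewrite !mxE /p /q; case: (l) (z i 0) => [? ?] [? ?].
  rewrite -Lz Im_mx_mull laplacian_mul_col -sumrN; apply: eq_bigr => j _.
  by rewrite !mxE -mulrN opprB.
move=> i; split.
  apply: within_continuousD cy _.
  exact: continuous_subspaceT (ch i).
move=> t t0 ct; have dyt := dy t t0 ct; have dht := dh i t.
apply: (@is_derive_eq _ _ _ (y + h i)).
(* The common term y drops out of the coupling. *)
have -> : \sum_j W i j * (y t + h j t - (y t + h i t)) =
    expR (al * t) * (cos (be * t) * (\sum_j W i j * (p j - p i)) -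
      sin (be * t) * (\sum_j W i j * (q j - q i))).
  rewrite !mulr_sumr -sumrB mulr_sumr; apply: eq_bigr => j _.
  by rewrite /h; ring.
by rewrite Lp Lq -/(p i) -/(q i) /h /al /be; ring.
Qed.

(* Applied to z and -iz, consensus forces both real coordinates of
   e^(mu t) (z_i - z_j) to vanish at infinity, while its modulus does not
   decrease. *)
Lemma consensus_eigenvector_const N (W : 'M[R]_N) a f b v
    (z : 'cV[R[i]]_N) (l : R[i]) :
  piecewise_continuous v -> achieves_consensus a f b W v ->
  toC (laplacian W) *m z = l *: z -> 0 <= complex.Re (a%:C - l * f%:C) ->
  forall i j, z i 0 = z j 0.
Proof.
move=> v_pc cons Lz; rewrite Re_shift => al_ge0 i j.
have [y cy dy] := linear_ode_solution a b v_pc.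
pose z' : 'cV[R[i]]_N := - 'i *: z.
have Lz' : toC (laplacian W) *m z' = l *: z'.
  by rewrite -scalemxAr Lz !scalerA mulrC.
have sol := @eigenvector_is_solution _ W a f b v y z l cy dy Lz.
have sol' := @eigenvector_is_solution _ W a f b v y z' l cy dy Lz'.
have := cons _ _ sol (fun=> erefl) i j.
have := cons _ _ sol' (fun=> erefl) i j.
set al := a - _; set be := - (_ * _).
pose P := complex.Re (z i 0) - complex.Re (z j 0).
pose Q := complex.Im (z i 0) - complex.Im (z j 0).
pose g (t : R) : R := expR (al * t) * (P * cos (be * t) - Q * sin (be * t)).
pose k (t : R) : R := expR (al * t) * (Q * cos (be * t) + P * sin (be * t)).
have z'E m : complex.Re (z' m 0) = complex.Im (z m 0) /\
    complex.Im (z' m 0) = - complex.Re (z m 0).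
  by rewrite mxE; case: (z m 0) => u w /=; split; ring.
rewrite [X in X @ _](_ : _ = k); last first.
  apply/funext => t; rewrite !(z'E _).1 !(z'E _).2 /k /P /Q; ring.
move=> k0; rewrite [X in X @ _](_ : _ = g); last first.
  by apply/funext => t; rewrite /g /P /Q; ring.
move=> g0.
have gk0 : (g t * g t + k t * k t) @[t --> +oo] --> (0 : R).
  have -> : 0 = 0 * 0 + 0 * 0 :> R by ring.
  by apply: cvgD; exact: cvgM.
(* g^2 + k^2 equals e^(2 al t) (P^2 + Q^2), which is at least P^2 + Q^2 for t >= 0 and yet tends to
   0. *)
have PQ0 : P * P + Q * Q <= 0.
  apply/ler_addgt0Pr => e e0; rewrite add0r; near (pinfty_nbhs R) => t.
  have : `|g t * g t + k t * k t| < e.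
    by near: t; exact: (@cvgr0_norm_lt _ _ _ _ _ _ gk0).
  have -> : g t * g t + k t * k t =
      expR (al * t) * expR (al * t) *
      ((P * P + Q * Q) * (cos (be * t) ^+ 2 + sin (be * t) ^+ 2)).
    by rewrite /g /k; ring.
  rewrite cos2Dsin2 mulr1 => /(le_lt_trans (ler_norm _))/ltW; apply: le_trans.
  apply: ler_peMl; first by rewrite addr_ge0 // -expr2 sqr_ge0.
  have e1 : 1 <= expR (al * t).
    by rewrite -expR0 ler_expR mulr_ge0.
  by rewrite mulr_ege1.
apply/eqP; rewrite eq_complex -[_ == _ :> R]subr_eq0 -/P -[X in _ && X]subr_eq0 -/Q.
have : P * P + Q * Q == 0 by rewrite eq_le PQ0 addr_ge0// -expr2 sqr_ge0.
by rewrite paddr_eq0 -?expr2 ?sqr_ge0// !sqrf_eq0.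
Unshelve. all: by end_near. Qed.

(** [eigenvalue] yields a row eigenvector; invariance of the determinant under transposition turns
    it into a column one. *)
Lemma eigenvalue_right_vector N (A : 'M[R[i]]_N) (lam : 'I_N -> R[i]) i :
  char_poly A = \prod_(k < N) ('X - (lam k)%:P) ->
  exists2 z : 'cV[R[i]]_N, A *m z = lam i *: z & z != 0.
Proof.
move=> hA.
have /eigenvalueP[w wA w0] : eigenvalue A (lam i).
  rewrite eigenvalue_root_char hA rootE horner_prod.
  by apply/prodf_eq0; exists i; rewrite ?hornerXsubC ?subrr.
have /det0P[u u0 uA] : \det (A - (lam i)%:M)^T == 0.
  rewrite det_tr; apply/det0P; exists w => //.
  by rewrite mulmxBr mul_mx_scalar wA subrr.
exists u^T; last first.
  by apply: contra u0 => /eqP/(congr1 trmx); rewrite trmxK trmx0 => ->.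
apply/eqP; rewrite -subr_eq0 -mul_scalar_mx -mulmxBl -[A - _]trmxK -trmx_mul.
by rewrite uA trmx0.
Qed.

End Consensus.

Theorem proposition1 (R : realType) (N : nat) (hN : (1 <= N)%N)
  (a f b : R) (ha : 0 < a) (hf : 0 < f) (hb : 0 < b)
  (W : 'M[R]_N) (hW : forall i j : 'I_N, 0 <= W i j)
  (v : R -> R) (hv : piecewise_continuous v)
  (lam : 'I_N -> R[i]) (hlam : eigenvalues_with_mult (laplacian W) lam) :
  achieves_consensus a f b W v <->
  (has_spanning_tree W /\
   forall i : 'I_N, lam i != 0 -> complex.Re (a%:C - lam i * f%:C) < 0).
Proof.
split=> [cons|[tree stable]]; last first.
  case: N hN W hW lam hlam tree stable => // n _ W hW lam hlam tree stable.
  exact: consensus_of_stable hlam tree stable.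
split.
  apply: contrapT => ntree.
  (* A kernel vector is an eigenvector for l = 0, whose growth rate mu = a is positive. *)
  have [x [Lx [i [j]]]] := laplacian_kernel_nonconst hW hN ntree.
  case/eqP.
  have Lz : map_mx (real_complex R) (laplacian W) *m map_mx (real_complex R) x =
      0 *: map_mx (real_complex R) x.
    by rewrite -map_mxM Lx map_mx0 scale0r.
  have := consensus_eigenvector_const hv cons Lz _ i j.
  rewrite mul0r subr0 !mxE => /(_ (ltW ha)) /(congr1 (@complex.Re R)).
  exact.
move=> i; apply: contraNT; rewrite -leNgt => unstable.
have [z Lz z0] := eigenvalue_right_vector i hlam.
(* The eigenvector is constant, so L kills it and its eigenvalue must be 0. *)
have zc := consensus_eigenvector_const hv cons Lz unstable.
have zE : z = const_mx (z i 0).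
  by apply/matrixP => k l; rewrite ord1 mxE.
move: Lz; rewrite {1}zE laplacianC_const => /esym/eqP.
by rewrite scaler_eq0 (negbTE z0) orbF.
Qed.
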